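(* Let $z_0\in V=(0,1)^2$ and $R>0$ with $\overline{B_R(z_0)}\subset V$. For a sequence $\eta\to0$ of positive numbers, radii $0<r_\eta\le R$ and open sets $I_\eta\subset(0,1)$, let $\Sigma_Y^\eta=T_{r_\eta,I_\eta}:=((0,1)\setminus I_\eta)\times B_{r_\eta}(z_0)$. Then $\Sigma_Y^\eta$ is asymptotically disconnected in the direction $e_2$, i.e. there exists a sequence $\Phi_\eta\in\dot H_\#(\operatorname{curl},Z)$ with $$\eta^{1/2}\|\Phi_\eta-e_2\|_{L^2(Z)}\to0,\qquad\Phi_\eta|_{\Sigma_Y^\eta}=0,\qquad\eta^{-1/2}\|\operatorname{curl}\Phi_\eta\|_{L^2(Z)}\to0 .$$ In fact, one can choose $\Phi_\eta=\Phi$ independent of $\eta$.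
   Context: $B_r(z_0)\subset\mathbb{R}^2$ is the disc of radius $r$ around $z_0$, placed in the coordinates $(x_2,x_3)$, so that $T_{r,I}=\{x\in\mathbb{R}^3:x_1\in(0,1)\setminus I,\ (x_2,x_3)\in B_r(z_0)\}$. $I_\eta$ consists of finitely many open intervals (gaps in the wire; $I_\eta=\emptyset$ is allowed). $Z=(0,1)^2\times\mathbb{R}$. $H_{\mathrm{loc}}(\operatorname{curl},\mathbb{R}^3)$ is the set of $u\in L^2_{\mathrm{loc}}(\mathbb{R}^3,\mathbb{C}^3)$ with distributional curl in $L^2_{\mathrm{loc}}(\mathbb{R}^3,\mathbb{C}^3)$, and $\dot H_\#(\operatorname{curl},Z)$ is the set of restrictions $u|_Z$ of functions $u\in H_{\mathrm{loc}}(\operatorname{curl},\mathbb{R}^3)$ that are $1$-periodic in the directions $e_1$ and $e_2$. Limits are along the sequence $\eta\to0$; vanishing on a set is understood almost everywhere. *)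

(* Defs.v *)
From HB Require Import structures.
From mathcomp Require Import all_boot all_order all_algebra.
From mathcomp Require Import complex.
From mathcomp Require Import all_classical all_reals all_analysis.

Set Implicit Arguments.
Unset Strict Implicit.
Unset Printing Implicit Defensive.
Import Order.TTheory GRing.Theory Num.Theory numFieldNormedType.Exports.
Local Open Scope classical_set_scope.
Local Open Scope ring_scope.

Notation R2 R := (measurableTypeR R * measurableTypeR R)%type.

(* A point x of R^3 is the triple (x_1, (x_2, x_3)), so that [x.2] is the
   projection to the (x_2, x_3)-plane.  The component indices 1, 2, 3 are the
   elements 0, 1, 2 of 'I_3. *)
Notation R3 R := (measurableTypeR R * R2 R)%type.

(* The library's sigma-finite instance on products of sigma-finite measures is
   shadowed by the one on products of subprobabilities, hence the explicit
   instances. *)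
Section product_lebesgue.
Context {R : realType}.

Definition lebesgue2 : set (R2 R) -> \bar R :=
  (@lebesgue_measure R \x @lebesgue_measure R)%E.

HB.instance Definition _ := Measure.on lebesgue2.

Lemma lebesgue2_sigma_finite : sigma_finite setT lebesgue2.
Proof.
have /sigma_finiteP[F [TF ndF Foo]] := sigma_finiteT (@lebesgue_measure R).
exists (fun n => F n `*` F n).
  rewrite -setXTT TF predeqE => -[x y]; split.
    move=> [/= [n _ Fnx] [k _ Fky]]; exists (maxn n k) => //; split.
    - by move: x Fnx; exact/subsetPset/ndF/leq_maxl.
    - by move: y Fky; exact/subsetPset/ndF/leq_maxr.
  by move=> [n _ []/= ? ?]; split; exists n.
move=> k; have [? ?] := Foo k.
split; first exact: measurableX.
by rewrite /lebesgue2 product_measure1E// lte_mul_pinfty// ge0_fin_numE.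
Qed.

HB.instance Definition _ :=
  Measure_isSigmaFinite.Build _ _ _ lebesgue2 lebesgue2_sigma_finite.

Definition lebesgue3 : set (R3 R) -> \bar R :=
  (@lebesgue_measure R \x lebesgue2)%E.

HB.instance Definition _ := Measure.on lebesgue3.

End product_lebesgue.

Section test_fields.
Context {R : realType}.
Implicit Types (Omega : set (R3 R)).

Definition basis3 (j : 'I_3) : R3 R :=
  ((j == 0)%:R, ((j == 1)%:R, (j == 2%:R)%:R)).

Fixpoint is_Ck (k : nat) (f : R3 R -> R) : Prop :=
  continuous f /\
  if k is k'.+1 then
    forall j, (forall x, derivable f x (basis3 j)) /\
              is_Ck k' ('D_(basis3 j) f)
  else True.

Definition test_field Omega (phi : R3 R -> 'rV[R]_3) : Prop :=
  (forall i k, is_Ck k (fun x => phi x 0 i)) /\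
  exists K : set (R3 R),
    [/\ compact K, K `<=` Omega & forall x, ~ K x -> phi x = 0].

(* Addition in 'I_3 is modulo 3, so this is the usual cyclic formula
   (curl phi)_i = d_{i+1} phi_{i+2} - d_{i+2} phi_{i+1}. *)
Definition classical_curl (phi : R3 R -> 'rV[R]_3) (x : R3 R) : 'rV[R]_3 :=
  \row_i ('D_(basis3 (i + 1)) (fun y => phi y 0 (i + 2%:R)) x
          - 'D_(basis3 (i + 2%:R)) (fun y => phi y 0 (i + 1)) x).

End test_fields.

Section complex_fields.
Context {R : realType}.
Local Notation mu := (@lebesgue3 R).
Local Notation field := (R3 R -> 'rV[R[i]]_3).
Implicit Types (Omega Sigma : set (R3 R)) (u w Phi : field).

Definition cnorm (v : 'rV[R[i]]_3) : R :=
  Num.sqrt (\sum_i (complex.Re (v 0 i) ^+ 2 + complex.Im (v 0 i) ^+ 2)).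

Definition cintegral Omega (f : R3 R -> R[i]) : R[i] :=
  Complex (\int[mu]_(x in Omega) complex.Re (f x))
          (\int[mu]_(x in Omega) complex.Im (f x)).

Definition L2norm Omega u : \bar R :=
  'N[mu]_2%:E[EFin \o ((fun x => cnorm (u x)) \_ Omega)]%E.

Definition cmeasurable Omega u : Prop :=
  forall i, measurable_fun Omega (fun x => complex.Re (u x 0 i)) /\
            measurable_fun Omega (fun x => complex.Im (u x 0 i)).

Definition L2loc Omega u : Prop :=
  cmeasurable Omega u /\
  forall K : set (R3 R), compact K -> K `<=` Omega -> (L2norm K u < +oo)%E.

(* [w] represents the distributional curl of [u] on the open set [Omega].  It
   is unique up to null sets.  Testing against real-valued test fields is the
   same as testing against complex-valued ones, by complex linearity. *)
Definition is_curl Omega u w : Prop :=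
  forall phi : R3 R -> 'rV[R]_3, test_field Omega phi ->
    cintegral Omega
      (fun x => \sum_i w x 0 i * real_complex R (phi x 0 i)) =
    cintegral Omega
      (fun x => \sum_i u x 0 i * real_complex R (classical_curl phi x 0 i)).

Definition is_L2loc_curl Omega u w : Prop := L2loc Omega w /\ is_curl Omega u w.

Definition Hloc_curl u : Prop :=
  L2loc setT u /\ exists w, is_L2loc_curl setT u w.

Definition periodic u (j : 'I_3) : Prop :=
  {ae mu, forall x, u (x + basis3 j) = u x}.

Definition domV : set (R2 R) := `]0, 1[ `*` `]0, 1[.

Definition domZ : set (R3 R) := `]0, 1[ `*` (`]0, 1[ `*` setT).

(* The values of [Phi] outside of [domZ] are irrelevant. *)
Definition Hper_curl Phi : Prop :=
  exists u, [/\ Hloc_curl u, periodic u 0, periodic u 1 &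
                forall x, domZ x -> Phi x = u x].

Definition evec (k : 'I_3) : 'rV[R[i]]_3 := delta_mx 0 k.

Definition disconnecting (eta : nat -> R) (Sigma : nat -> set (R3 R))
    (k : 'I_3) (Phi : nat -> field) : Prop :=
  [/\ forall n, Hper_curl (Phi n),
      ((Num.sqrt (eta n))%:E * L2norm domZ (fun x => Phi n x - evec k)%R)%E
        @[n --> \oo] --> 0%E,
      forall n, {ae mu, forall x, Sigma n x -> Phi n x = 0} &
      exists curlPhi : nat -> field,
        (forall n, is_L2loc_curl domZ (Phi n) (curlPhi n)) /\
        ((Num.sqrt (eta n))^-1%:E * L2norm domZ (curlPhi n))%E
          @[n --> \oo] --> 0%E].

Definition asymptotically_disconnected (eta : nat -> R)
    (Sigma : nat -> set (R3 R)) (k : 'I_3) : Prop :=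
  exists Phi : nat -> field, disconnecting eta Sigma k Phi.

(* The Euclidean disc; the library's [ball] on a product is a square. *)
Definition disc (z : R2 R) (r : R) : set (R2 R) :=
  [set p | (p.1 - z.1) ^+ 2 + (p.2 - z.2) ^+ 2 < r ^+ 2].

Definition finite_union_open_itv (I : set R) : Prop :=
  exists s : seq (R * R), I = \bigcup_(p in [set` s]) `]p.1, p.2[%classic.

Definition wire (z : R2 R) (r : R) (I : set R) : set (R3 R) :=
  (`]0, 1[ `\` I) `*` disc z r.

End complex_fields.

(* Main.v *)
Require Import Defs.
From HB Require Import structures.
From mathcomp Require Import all_boot all_order all_algebra.
From mathcomp Require Import complex.
From mathcomp Require Import all_classical all_reals all_analysis.
From mathcomp Require Import ring lra.
Import Order.TTheory GRing.Theory Num.Theory numFieldNormedType.Exports.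
Local Open Scope classical_set_scope.
Local Open Scope ring_scope.

(** The field is the gradient of a function g of (x_2, x_3) alone which equals
    x_2 for large |x_3| and is constant on the disc.  A gradient has no curl,
    so the third limit holds because its terms vanish, and a single field serves
    all eta because the disc of radius rho contains every cross-section.

    Such a g exists because the projection of the disc to the x_2-axis lies
    strictly inside a period cell: some 1-periodic h satisfies
    h(t) = -(t - c) on that projection, c being the first coordinate of z0,
    and then x_2 + h(x_2) is constant there.  With a cut-off chi equal to 1 on
    the projection of the disc to the x_3-axis, put
      g = x_2 + chi(x_3) h(x_2),
      grad g = (0, 1 + chi(x_3) h'(x_2), chi'(x_3) h(x_2)).
    The gradient is periodic, vanishes over the disc, and differs from e_2 only
    on a slab |x_3| <= N, whose part in the cell Z is bounded, so
    that the L2 distance to e_2 is a finite constant.  It is enough to take h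
    and chi of class C^1, built from the C^1 function max(0, y)^2
    ([bump_exists], [is_derive_periodize]).

    The field itself is then only continuous, so curl grad g = 0 has to be read
    distributionally ([integral_layer_field_curl]).  For a test field phi, the
    product grad g . curl phi is a sum of three partial derivatives of
    compactly supported functions, each of them differentiable in the one
    direction that matters; a partial derivative of a compactly supported
    function integrates to zero by Fubini's theorem and the fundamental theorem
    of calculus on lines ([integral_partial0]).  Measurability of the integrands
    for the product sigma-algebra comes from the countable basis of rational
    boxes ([open_measurable_R3]). *)

Set Implicit Arguments.
Unset Strict Implicit.
Unset Printing Implicit Defensive.

(** * Borel measurability and boundedness in R^3 *)

Section measurability.
Context {R : realType}.

Lemma nbhs_ratr_itv (x : R) (A : set R) : nbhs x A ->
  exists p : rat * rat, `]ratr p.1, ratr p.2[%classic x /\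
    `]ratr p.1, ratr p.2[%classic `<=` A.
Proof.
move=> /nbhs_ballP[e /= e0 xeA].
have [p /[!in_itv]/= /andP[p1 p2]] : exists q : rat, ratr q \in `]x - e, x[.
  by apply: rat_in_itvoo; lra.
have [q /[!in_itv]/= /andP[q1 q2]] : exists q : rat, ratr q \in `]x, x + e[.
  by apply: rat_in_itvoo; lra.
exists (p, q); split => /=; first by rewrite in_itv/= p2 q1.
move=> y /=; rewrite in_itv/= => /andP[y1 y2]; apply: xeA.
rewrite /ball/= ltr_distl; apply/andP; split; lra.
Qed.

Let ratbox (q : (rat * rat) * ((rat * rat) * (rat * rat))) : set (R3 R) :=
  `]ratr q.1.1, ratr q.1.2[ `*`
  (`]ratr q.2.1.1, ratr q.2.1.2[ `*` `]ratr q.2.2.1, ratr q.2.2.2[).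

(** The sigma-algebra of the product is generated by boxes; every open set is
    the union of the rational boxes that it contains, and these are countably
    many. *)
Lemma open_measurable_R3 (U : set (R3 R)) : open U -> measurable U.
Proof.
move=> oU.
rewrite (_ : U = \bigcup_q (if `[< ratbox q `<=` U >] then ratbox q else set0)).
  apply: countable_bigcupT_measurable => // q.
  case: ifPn => // _.
  by apply: measurableX => //; apply: measurableX.
apply/seteqP; split => [x Ux|x [q _]]; last by case: asboolP => // qU /qU.
have /= [[A B] [/= xA [[/= C D] [/= xC xD] CDB] ABU]] := open_nbhs_nbhs (conj oU Ux).
have [p1 [xp1 p1A]] := nbhs_ratr_itv xA.
have [p2 [xp2 p2C]] := nbhs_ratr_itv xC.
have [p3 [xp3 p3D]] := nbhs_ratr_itv xD.
exists (p1, (p2, p3)) => //; case: asboolP => // -[].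
move=> y [y1 [y2 y3]]; apply: ABU; split; first exact: p1A.
by apply: CDB; split; [exact: p2C|exact: p3D].
Qed.

Lemma continuous_measurable_R3 (f : R3 R -> R) :
  continuous f -> measurable_fun setT f.
Proof.
move=> /continuousP cf; apply: (measurability _ (measurable_realfun.RGenOpens.measurableE R)).
move=> _ [_ [a [b ->] <-]]; rewrite setTI; apply: open_measurable_R3.
exact/cf/interval_open.
Qed.

Lemma compact_measurable_R3 (K : set (R3 R)) : compact K -> measurable K.
Proof.
move=> /(compact_closed (@norm_hausdorff _ _)) /closed_openC.
by move=> /open_measurable_R3 /measurableC; rewrite setCK.
Qed.

Definition cube (N : R) : set (R3 R) := `[- N, N] `*` (`[- N, N] `*` `[- N, N]).

Lemma compact_cube (N : R) : compact (cube N).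
Proof.
by do 2![apply: compact_setX; first exact: segment_compact]; exact: segment_compact.
Qed.

Lemma closed_cube (N : R) : closed (cube N).
Proof. by apply: compact_closed (@compact_cube N); exact: norm_hausdorff. Qed.

Lemma measurable_cube (N : R) : measurable (cube N).
Proof. by apply: compact_measurable_R3; exact: compact_cube. Qed.

Definition square (N : R) : set (R2 R) := `[- N, N] `*` `[- N, N].

Lemma lebesgue2_square (N : R) : (lebesgue2 (square N) < +oo)%E.
Proof.
rewrite /lebesgue2 /square product_measure1E//= lte_mul_pinfty//.
- by rewrite lebesgue_measure_itv/=; case: ifP; rewrite // -EFinB.
- by rewrite lebesgue_measure_itv/=; case: ifP; rewrite // -EFinB ltry.
Qed.

Lemma lebesgue3_cube (N : R) : (lebesgue3 (cube N) < +oo)%E.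
Proof.
rewrite /lebesgue3 /cube product_measure1E//=; last exact: measurableX.
rewrite lte_mul_pinfty ?lebesgue2_square//.
by rewrite lebesgue_measure_itv/=; case: ifP; rewrite // -EFinB.
Qed.

Lemma continuous_bounded_on (f : R3 R -> R) (K : set (R3 R)) :
  continuous f -> compact K -> exists M, forall x, K x -> `|f x| <= M.
Proof.
move=> cf cK.
have /compact_bounded[M [Mr MK]] : compact (f @` K).
  by apply: continuous_compact => //; exact: continuous_subspaceT.
exists (`|M| + 1) => x Kx.
apply: (MK (`|M| + 1)); last by exists x.
by rewrite ltr_pwDr// ler_norm.
Qed.

Lemma compact_sub_cube (K : set (R3 R)) : compact K -> exists N, K `<=` cube N.
Proof.
move=> cK.
have [M1 K1] : exists M, forall x, K x -> `|x.1| <= M.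
  by apply: continuous_bounded_on cK => x; exact: cvg_fst.
have [M2 K2] : exists M, forall x, K x -> `|x.2.1| <= M.
  apply: continuous_bounded_on cK => x.
  by apply: (@continuous_comp _ _ _ snd fst); [exact: cvg_snd|exact: cvg_fst].
have [M3 K3] : exists M, forall x, K x -> `|x.2.2| <= M.
  apply: continuous_bounded_on cK => x.
  by apply: (@continuous_comp _ _ _ snd snd); exact: cvg_snd.
exists (Num.max M1 (Num.max M2 M3)) => x Kx; rewrite /cube/= !in_itv/= -!ler_norml.
by rewrite !le_max K1// K2// K3// !orbT.
Qed.

End measurability.

(** * C^1 cut-off functions and periodization on the line *)

Section bump.
Context {R : realType}.

(** A C^1 function that vanishes exactly on a half-line: composing with it
    produces the plateaus of the cut-offs. *)
Definition possq (y : R) : R := Num.max 0 y ^+ 2.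
Definition dpossq (y : R) : R := 2 * Num.max 0 y.

Lemma possq0 y : y <= 0 -> possq y = 0.
Proof. by move=> y0; rewrite /possq max_l// expr0n. Qed.

Lemma dpossq0 y : y <= 0 -> dpossq y = 0.
Proof. by move=> y0; rewrite /dpossq max_l// mulr0. Qed.

Lemma is_derive_possq (y : R) : is_derive y 1 possq (dpossq y).
Proof.
have [y0|y0|->] := ltgtP y 0.
- rewrite dpossq0; last exact: ltW.
  apply: (@near_eq_is_derive _ _ _ (cst 0)); near=> z.
  by rewrite possq0//; near: z; exact: lt_le_nbhsl.
- rewrite /dpossq max_r; last exact: ltW.
  apply: (@near_eq_is_derive _ _ _ (fun z : R => z ^+ 2)); last first.
    by apply: is_derive_eq; rewrite /GRing.scale/=; ring.
  near=> z; rewrite /possq max_r//; near: z; exact: lt_le_nbhsr.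
(* At 0 the difference quotient of max(0, h)^2 is max(0, h). *)
- have H : h^-1 *: (possq (h *: 1 + 0) - possq 0) @[h --> (0 : R)^'] --> (0 : R).
    apply: (@cvg_trans _ (Num.max 0 h @[h --> (0 : R)^'])).
      apply: near_eq_cvg; near=> h.
      have h0 : h != 0 by near: h; exact: nbhs_dnbhs_neq.
      rewrite addr0 (possq0 (lexx _)) subr0 /GRing.scale/= mulr1 /possq.
      by have [?|?] := leP 0 h; rewrite ?expr0n ?mulr0// expr2 mulKf.
    apply: cvg_within_filter.
    have : {for (0 : R), continuous (fun h : R => Num.max 0 h)}.
      by apply: (@continuous_max _ _ (cst 0) id); [exact: cvg_cst|exact: cvg_id].
    by rewrite /prop_for /continuous_at maxxx.
  rewrite dpossq0//; apply: DeriveDef; first by apply/cvg_ex; exists 0.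
  exact/cvg_lim.
Unshelve. all: by end_near. Qed.

Lemma continuous_dpossq : continuous dpossq.
Proof.
move=> y; apply: cvgM; first exact: cvg_cst.
by apply: (@continuous_max _ _ (cst 0) id); [exact: cvg_cst|exact: cvg_id].
Qed.

(** Composing [possq] with itself gives a formula valid on the whole line:
    possq(1 - possq((t - c)^2 - rho^2) / K), where the constant K is the value of
    the inner [possq] at distance sigma from c. *)
Lemma bump_exists (c rho sigma : R) : 0 <= rho < sigma ->
  exists B B' : R -> R, [/\ continuous B', forall t : R, is_derive t 1 B (B' t),
    forall t, `|t - c| <= rho -> B t = 1 /\ B' t = 0 &
    forall t, sigma <= `|t - c| -> B t = 0 /\ B' t = 0].
Proof.
move=> /andP[rho0 rs].
have K0 : 0 < sigma ^+ 2 - rho ^+ 2 by rewrite subr_gt0 ltr_sqr// nnegrE; lra.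
pose K := (sigma ^+ 2 - rho ^+ 2) ^+ 2.
pose q t := (t - c) ^+ 2 - rho ^+ 2.
exists (fun t => possq (1 - K^-1 * possq (q t))).
exists (fun t => dpossq (1 - K^-1 * possq (q t)) *
                 (- (K^-1 * (dpossq (q t) * (2 * (t - c)))))).
have dq (t : R) : is_derive t 1 q (2 * (t - c)).
  apply: is_derive_eq; rewrite /GRing.scale/= ; ring.
have dpq (t : R) : is_derive t 1 (possq \o q) (dpossq (q t) * (2 * (t - c))).
  by apply: is_derive1_comp; exact: is_derive_possq.
have cq : continuous q by move=> t; apply: differentiable_continuous; exact/derivable1_diffP.
have cpq : continuous (possq \o q).
  by move=> t; apply: differentiable_continuous; exact/derivable1_diffP.
have cdpq : continuous (dpossq \o q).
  by move=> t; apply: continuous_comp; [exact: cq|exact: continuous_dpossq].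
split.
- have c1 : continuous (fun t => 1 - K^-1 * possq (q t)).
    move=> t; apply: cvgB; first exact: cvg_cst.
    by apply: cvgM; [exact: cvg_cst|exact: cpq].
  move=> t; apply: cvgM.
    by apply: (continuous_comp (c1 t)); exact: continuous_dpossq.
  apply: cvgN; apply: cvgM; first exact: cvg_cst.
  apply: cvgM; first exact: cdpq.
  by apply: cvgM; [exact: cvg_cst|apply: cvgB; [exact: cvg_id|exact: cvg_cst]].
- move=> t; apply: (@is_derive1_comp _ possq (fun t => 1 - K^-1 * possq (q t))).
    exact: is_derive_possq.
  apply: is_derive_eq.
  by rewrite add0r mul1r.
- move=> t; rewrite -ler_sqr ?nnegrE// real_normK ?num_real// => tc.
  have q0 : q t <= 0 by rewrite subr_le0.
  by rewrite (possq0 q0) (dpossq0 q0) !(mul0r, mulr0, oppr0, subr0) /possq max_r// expr1n.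
- move=> t; rewrite -ler_sqr ?nnegrE//; last lra.
  rewrite real_normK ?num_real// => tc.
  have q0 : 1 - K^-1 * possq (q t) <= 0.
    rewrite subr_le0 mulrC ler_pdivlMr ?mul1r; last by rewrite /K exprn_gt0.
    rewrite /K /possq ler_sqr ?nnegrE ?le_max ?lexx//; last exact: ltW.
    by rewrite lerD2r tc orbT.
  by rewrite (possq0 q0) (dpossq0 q0) mul0r.
Qed.

Definition periodize (G : R -> R) (x : R) : R := G (x - (Num.floor x)%:~R).

Lemma periodize_add1 G x : periodize G (x + 1) = periodize G x.
Proof.
rewrite /periodize (_ : Num.floor (x + 1) = Num.floor x + 1).
  by rewrite intrD; congr G; ring.
apply: floor_def; have := floor_itv x; rewrite !intrD => /andP[? ?].
by apply/andP; split; lra.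
Qed.

(** On the two cells that meet at n, the periodization is a sum of two
    translates, because G vanishes off the unit interval: this form has no jump
    to be handled at n. *)
Lemma periodizeE (G : R -> R) (n : int) x :
  (forall t, t <= 0 -> G t = 0) -> (forall t, 1 <= t -> G t = 0) ->
  n%:~R - 1 < x < n%:~R + 1 ->
  periodize G x = G (x - n%:~R) + G (x - n%:~R + 1).
Proof.
move=> G0 G1 /andP[n1 n2]; rewrite /periodize.
have [xn|nx] := ltP x n%:~R.
  have -> : Num.floor x = n - 1.
    by apply/eqP; rewrite floor_eq subrK intrB; apply/andP; split; lra.
  rewrite (G0 (x - n%:~R)) ?add0r; last lra.
  by congr G; rewrite intrB; ring.
have -> : Num.floor x = n.
  by apply/eqP; rewrite floor_eq intrD; apply/andP; split; lra.
by rewrite (G1 (x - n%:~R + 1)) ?addr0//; lra.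
Qed.

Let near_periodizeE (G : R -> R) (x : R) :
  (forall t, t <= 0 -> G t = 0) -> (forall t, 1 <= t -> G t = 0) ->
  let n : R := (Num.floor x)%:~R in
  \forall y \near x, G (y - n) + G (y - n + 1) = periodize G y.
Proof.
move=> G0 G1 n; have /andP[n1 n2] := floor_itv x.
near=> y; rewrite (periodizeE (n := Num.floor x))//.
near: y; apply: near_in_itvoo => /=.
by rewrite in_itv/=; move: n2; rewrite intrD => n2; apply/andP; split; lra.
Unshelve. all: by end_near. Qed.

Lemma continuous_periodize (G : R -> R) : continuous G ->
  (forall t, t <= 0 -> G t = 0) -> (forall t, 1 <= t -> G t = 0) ->
  continuous (periodize G).
Proof.
move=> cG G0 G1 x; set n : R := (Num.floor x)%:~R.
have H := near_periodizeE x G0 G1.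
rewrite /continuous_at -(nbhs_singleton H).
apply: cvg_trans; first exact: (near_eq_cvg H).
apply: cvgD.
  apply: (@continuous_comp _ _ _ (fun y => y - n) G); last exact: cG.
  by apply: cvgB; [exact: cvg_id|exact: cvg_cst].
apply: (@continuous_comp _ _ _ (fun y => y - n + 1) G); last exact: cG.
by apply: cvgD; [apply: cvgB; [exact: cvg_id|exact: cvg_cst]|exact: cvg_cst].
Qed.

Lemma is_derive_periodize (G G' : R -> R) (x : R) :
  (forall t : R, is_derive t 1 G (G' t)) ->
  (forall t, t <= 0 -> G t = 0 /\ G' t = 0) ->
  (forall t, 1 <= t -> G t = 0 /\ G' t = 0) ->
  is_derive x 1 (periodize G) (periodize G' x).
Proof.
move=> dG G0 G1; set n : R := (Num.floor x)%:~R.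
have H := near_periodizeE x (fun t t0 => (G0 t t0).1) (fun t t0 => (G1 t t0).1).
have H' := near_periodizeE x (fun t t0 => (G0 t t0).2) (fun t t0 => (G1 t t0).2).
apply: near_eq_is_derive H _.
rewrite -(nbhs_singleton H').
have shift (k : R) : is_derive x 1 (fun y => G (y + k)) (G' (x + k)).
  have -> : G' (x + k) = G' (x + k) * 1 by rewrite mulr1.
  apply: (@is_derive1_comp _ G (fun y => y + k)).
  by apply: is_derive_eq; rewrite addr0.
under eq_fun do rewrite -addrA.
by rewrite -addrA; apply: is_deriveD; exact: shift.
Qed.

End bump.

(** * Integrals of partial derivatives *)

Section partial.
Context {R : realType}.

Lemma derive_outside {V W : normedModType R} (K : set V) (f : V -> W) (v x : V) :
  closed K -> (forall y, ~ K y -> f y = 0) -> ~ K x -> 'D_v f x = 0.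
Proof.
move=> cK f0 Kx; rewrite -(derive_cst (0 : W) x v).
apply: near_eq_derive; near=> y; apply: f0.
near: y; apply: open_nbhs_nbhs; split => //; exact: closed_openC.
Unshelve. all: by end_near. Qed.

(** A directional derivative is a derivative of a function of one variable along
    a line. *)
Lemma is_derive_line (V : normedModType R) (f : V -> R) (v : V) (g : R -> V)
    (t d : R) : (forall h, g (h + t) = h *: v + g t) ->
  is_derive (g t) v f d <-> is_derive t 1 (f \o g) d.
Proof.
move=> gE.
have E : (fun h : R => h^-1 *: ((f \o g) (h *: 1 + t) - (f \o g) t)) =
    (fun h : R => h^-1 *: (f (h *: v + g t) - f (g t))).
  by apply/funext => h /=; rewrite -gE /GRing.scale/= mulr1.
have dE : derivable (f \o g) t 1 = derivable f (g t) v by rewrite /derivable E.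
have DE : 'D_1 (f \o g) t = 'D_v f (g t) by rewrite /derive E.
by split=> -[fv <-]; split; [rewrite dE|rewrite DE|rewrite -dE|rewrite -DE].
Qed.

Lemma integral_derivative0 (f f' : R -> R) (N : R) :
  (forall t : R, is_derive t 1 f (f' t)) -> continuous f' ->
  (forall t : R, ~ `[- N, N]%classic t -> f t = 0) ->
  (forall t : R, ~ `[- N, N]%classic t -> f' t = 0) ->
  (\int[lebesgue_measure]_t (f' t)%:E = 0)%E.
Proof.
move=> df cf' f0 f'0.
(* The enlarged interval has a nonempty interior whatever the sign of N, and f
   vanishes at its endpoints. *)
pose M : R := `|N| + 1.
have NM : N < M by rewrite /M ltr_pwDr// ler_norm.
have M0 : 0 < M by rewrite /M ltr_pwDr.
have -> : (\int[lebesgue_measure]_t (f' t)%:E =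
           \int[lebesgue_measure]_(t in `[(- M)%R, M]) (f' t)%:E)%E.
  rewrite [RHS]integral_mkcond; apply: eq_integral => t _.
  rewrite patchE; case: ifPn => // /negP tM; rewrite f'0// => /= tN; apply: tM.
  rewrite inE/= in_itv/=; move: tN; rewrite in_itv/= => /andP[? ?].
  by apply/andP; split; lra.
have cf : continuous f.
  by move=> t; apply: differentiable_continuous; apply/derivable1_diffP.
rewrite (@continuous_FTC2 _ f' f); [|lra|exact: continuous_subspaceT| |].
- rewrite !f0 ?subee//= in_itv/= => /andP[]; lra.
- split => //; first exact: cvg_at_right_filter (cf _).
  exact: cvg_at_left_filter (cf _).
- by move=> t _; rewrite derive1E; exact: derive_val.
Qed.

Lemma continuous_integrable_R3 (f : R3 R -> R) (N : R) : continuous f ->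
  (forall x, ~ cube N x -> f x = 0) ->
  lebesgue3.-integrable setT (EFin \o f).
Proof.
move=> cf f0; have mC := measurable_cube N.
rewrite (_ : _ \o _ = (EFin \o f) \_ (cube N)); last first.
  apply/funext => x; rewrite patchE; case: ifPn => // /negP xN.
  by rewrite /= f0// => /mem_set.
apply/(integrable_mkcond _ mC)/measurable_bounded_integrable => //.
- exact: lebesgue3_cube.
- by apply: measurable_funTS; exact: continuous_measurable_R3.
have [M fM] := continuous_bounded_on cf (@compact_cube _ N).
exists M; split; first exact: num_real.
by move=> y My x Cx; rewrite /= (le_trans (fM _ Cx))// ltW.
Qed.

(** Measurability is inherited from R^3, where f is read as a function that does
    not depend on the first coordinate. *)
Lemma continuous_integrable_R2 (f : R2 R -> R) (N : R) : continuous f ->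
  (forall x, ~ square N x -> f x = 0) ->
  lebesgue2.-integrable setT (EFin \o f).
Proof.
move=> cf f0; have mC : measurable (square N) by exact: measurableX.
have cf2 : continuous (fun x : R3 R => f x.2).
  by move=> x; apply: (@continuous_comp _ _ _ snd f); [exact: cvg_snd|exact: cf].
rewrite (_ : _ \o _ = (EFin \o f) \_ (square N)); last first.
  apply/funext => x; rewrite patchE; case: ifPn => // /negP xN.
  by rewrite /= f0// => /mem_set.
apply/(integrable_mkcond _ mC)/measurable_bounded_integrable => //.
- exact: lebesgue2_square.
- apply: measurable_funTS.
  rewrite (_ : f = (fun x : R3 R => f x.2) \o pair 0)//.
  by apply: measurableT_comp; [exact: continuous_measurable_R3|].
have [M fM] := continuous_bounded_on cf2 (@compact_cube _ N).
exists M; split; first exact: num_real.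
move=> y My x Cx; rewrite /= (le_trans _ (ltW My))//.
(* A negative N makes the square empty, and then (0, x) need not lie in the cube. *)
have [N0|N0] := leP 0 N.
  by apply: (fM (0, x)); split => //=; rewrite in_itv/=; apply/andP; split; lra.
case: Cx => /=; rewrite in_itv/= => /andP[? ?]; lra.
Qed.

(** The next three lemmas parametrize the lines parallel to the axes in the form
    that [is_derive_line] takes. *)
Lemma line1E (p : R2 R) (h t : R) : (h + t, p) = h *: basis3 0 + (t, p) :> R3 R.
Proof.
apply: injective_projections => /=; last by rewrite scaler0 add0r.
by rewrite /GRing.scale/= mulr1.
Qed.

Lemma line2E (x1 x3 h t : R) :
  (x1, (h + t, x3)) = h *: basis3 1 + (x1, (t, x3)) :> R3 R.
Proof.
apply: injective_projections => /=; first by rewrite /GRing.scale/= mulr0 add0r.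
by apply: injective_projections; rewrite /= /GRing.scale/= ?mulr1// mulr0 add0r.
Qed.

Lemma line3E (x1 x2 h t : R) :
  (x1, (x2, h + t)) = h *: basis3 2%:R + (x1, (x2, t)) :> R3 R.
Proof.
apply: injective_projections => /=; first by rewrite /GRing.scale/= mulr0 add0r.
by apply: injective_projections; rewrite /= /GRing.scale/= ?mulr1// mulr0 add0r.
Qed.

(** Integrating first along the lines parallel to [basis3 j], each inner integral
    vanishes by the fundamental theorem of calculus.  Differentiability is asked
    in this single direction, as the functions met below have no more. *)
Lemma integral_partial0 (j : 'I_3) (f f' : R3 R -> R) (N : R) :
  (forall x, is_derive x (basis3 j) f (f' x)) -> continuous f' ->
  (forall x, ~ cube N x -> f x = 0) ->
  lebesgue3.-integrable setT (EFin \o f') /\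
  (\int[lebesgue3]_x (f' x)%:E = 0)%E.
Proof.
move=> df cf' f0.
have f'0 x : ~ cube N x -> f' x = 0.
  move=> Nx; rewrite -(@derive_val _ _ _ _ _ _ _ (df x)).
  exact: (derive_outside (basis3 j) (@closed_cube _ N) f0).
have intf' := continuous_integrable_R3 cf' f'0.
have intf'2 x1 : lebesgue2.-integrable setT (EFin \o (fun p => f' (x1, p))).
  apply: (@continuous_integrable_R2 _ N) => [p|p Np]; last by apply: f'0 => -[].
  apply: (@continuous_comp _ _ _ (pair x1) f'); last exact: cf'.
  exact: cvg_pair (cvg_cst _) cvg_id.
have line (g : R -> R3 R) : continuous g ->
    (forall h t, g (h + t) = h *: basis3 j + g t) ->
    (forall t : R, ~ `[- N, N]%classic t -> ~ cube N (g t)) ->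
    (\int[lebesgue_measure]_t (f' (g t))%:E = 0)%E.
  move=> cg gE gN; apply: (@integral_derivative0 (f \o g) (f' \o g) N).
  - move=> t; have [H _] := @is_derive_line _ f (basis3 j) g t (f' (g t)) (gE ^~ t).
    exact: H.
  - by move=> t; apply: (@continuous_comp _ _ _ g f'); [exact: cg|exact: cf'].
  - by move=> t /gN /f0.
  - by move=> t /gN /f'0.
split=> //; case: j df line => -[|[|[|//]]] j3 df line.
- rewrite -(integral21_prod_meas1 intf').
  under eq_integral => p _.
    rewrite /fubini_G/= (line (fun t => (t, p))); first over.
  + by move=> t; exact: cvg_pair cvg_id (cvg_cst _).
  + by move=> h t; exact: line1E.
  + by move=> t tN [].
  by rewrite integral0.
- rewrite -(integral12_prod_meas1 intf').
  under eq_integral => x1 _.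
    rewrite /fubini_F/= -(integral21_prod_meas1 (intf'2 x1)).
    under eq_integral => x3 _.
      rewrite /fubini_G/= (line (fun t => (x1, (t, x3)))); first over.
    + by move=> t; exact: cvg_pair (cvg_cst _) (cvg_pair cvg_id (cvg_cst _)).
    + by move=> h t; exact: line2E.
    + by move=> t tN [_ []].
    by rewrite integral0; over.
  by rewrite integral0.
- rewrite -(integral12_prod_meas1 intf').
  under eq_integral => x1 _.
    rewrite /fubini_F/= -(integral12_prod_meas1 (intf'2 x1)).
    under eq_integral => x2 _.
      rewrite /fubini_F/= (line (fun t => (x1, (x2, t)))); first over.
    + by move=> t; exact: cvg_pair (cvg_cst _) (cvg_pair (cvg_cst _) cvg_id).
    + by move=> h t; exact: line3E.
    + by move=> t tN [_ []].
    by rewrite integral0; over.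
  by rewrite integral0.
Qed.

End partial.

(** * Real-valued fields, their L2 norms and their distributional curls *)

Section fields.
Context {R : realType}.
Local Notation mu := (@lebesgue3 R).

Definition real_field (U : 'I_3 -> R3 R -> R) (x : R3 R) : 'rV[R[i]]_3 :=
  \row_i real_complex R (U i x).

Lemma cnorm0 : cnorm (0 : 'rV[R[i]]_3) = 0.
Proof.
by rewrite /cnorm big1 ?sqrtr0// => i _; rewrite mxE /= expr0n addr0.
Qed.

Lemma cnorm_real_field U x :
  cnorm (real_field U x) = Num.sqrt (\sum_i U i x ^+ 2).
Proof.
by congr Num.sqrt; apply: eq_bigr => i _; rewrite mxE /= expr0n addr0.
Qed.

Lemma continuous_cnorm (U : 'I_3 -> R3 R -> R) : (forall i, continuous (U i)) ->
  continuous (fun x => cnorm (real_field U x)).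
Proof.
move=> cU; rewrite (_ : (fun _ => _) = Num.sqrt \o (fun x => \sum_i U i x ^+ 2)).
  move=> x; apply: continuous_comp; last exact: sqrt_continuous.
  under [fun x => \sum_i _]eq_fun do rewrite !big_ord_recl big_ord0.
  do 3!(apply: cvgD; first by apply: cvgM; exact: cU).
  exact: cvg_cst.
by apply/funext => x; rewrite cnorm_real_field.
Qed.

(** Up to a set where u vanishes, the integral is that of a continuous function
    over a bounded set.  Compact sets and the strip [domZ] are both covered by
    this form. *)
Lemma L2norm_lty (Omega : set (R3 R)) (u : R3 R -> 'rV[R[i]]_3) (N : R) :
  measurable Omega -> continuous (fun x => cnorm (u x)) ->
  (forall x, Omega x -> ~ cube N x -> u x = 0) ->
  (L2norm Omega u < +oo)%E.
Proof.
move=> mO cu u0; pose A := Omega `&` cube N.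
have mA : measurable A by apply: measurableI => //; exact: measurable_cube.
have cu2 : continuous (fun x => cnorm (u x) ^+ 2).
  by move=> x; apply: cvgM; exact: cu.
have Afin : (mu A < +oo)%E.
  apply: le_lt_trans (lebesgue3_cube N); apply: le_measure; rewrite ?inE//.
    exact: measurable_cube.
  exact: subIsetr.
have : mu.-integrable A (EFin \o (fun x => cnorm (u x) ^+ 2)).
  apply: measurable_bounded_integrable => //.
    by apply: measurable_funTS; exact: continuous_measurable_R3.
  have [M uM] := continuous_bounded_on cu2 (@compact_cube _ N).
  exists M; split; first exact: num_real.
  by move=> y My x [_ Cx]; rewrite /= (le_trans (uM _ Cx))// ltW.
move=> /integrableP[_ intA].
rewrite /L2norm Lnorm.unlock; apply: poweR_lty; apply: le_lt_trans intA.
rewrite [leRHS]integral_mkcond le_eqVlt; apply/orP; left; apply/eqP.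
apply: eq_integral => x _; rewrite /= patchE.
rewrite [X in (_ = X)%E]patchE.
have [Ox|nOx] := pselect (Omega x); last first.
  rewrite !memNset//; last by move=> -[].
  by rewrite /point/= normr0 powR0// pnatr_eq0.
rewrite (mem_set Ox).
have [Cx|nCx] := pselect (cube N x).
  by rewrite mem_set//= powR_mulrn// normrX.
rewrite memNset; last by move=> -[].
by rewrite u0// cnorm0 /= normr0 powR0// pnatr_eq0.
Qed.

Lemma L2norm0 (Omega : set (R3 R)) : L2norm Omega (fun=> 0) = 0%E.
Proof.
rewrite /L2norm -[RHS](@Lnorm0 _ _ _ mu 2%:E); last by rewrite eqe pnatr_eq0.
by apply: eq_Lnorm => x /=; rewrite patchE cnorm0; case: ifP.
Qed.

Lemma L2loc0 (Omega : set (R3 R)) : L2loc Omega (fun=> 0).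
Proof.
split=> [i|K cK KO]; last by rewrite L2norm0 ltry.
by split; rewrite mxE; exact: measurable_cst.
Qed.

Lemma L2loc_real_field (Omega : set (R3 R)) (U : 'I_3 -> R3 R -> R) :
  (forall i, continuous (U i)) -> L2loc Omega (real_field U).
Proof.
move=> cU; split=> [i|K cK _].
  split; under eq_fun do rewrite mxE /=; last exact: measurable_cst.
  by apply: measurable_funTS; exact: continuous_measurable_R3.
have [N KN] := compact_sub_cube cK.
apply: (@L2norm_lty _ _ N); first exact: compact_measurable_R3.
  exact: continuous_cnorm.
by move=> x /KN.
Qed.

Lemma cintegral_support (Omega : set (R3 R)) (f : R3 R -> R[i]) :
  (forall x, ~ Omega x -> f x = 0) -> cintegral Omega f = cintegral setT f.
Proof.
move=> f0; rewrite /cintegral !(Rintegral_mkcond _ Omega).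
by congr Complex; apply: eq_Rintegral => x _; rewrite patchE;
  case: ifPn => // /negP xO; rewrite f0// => /mem_set.
Qed.

Lemma test_field_setT (Omega : set (R3 R)) phi :
  test_field Omega phi -> test_field setT phi.
Proof. by move=> [Ck [K [cK _ phi0]]]; split=> //; exists K; split. Qed.

Lemma classical_curl_outside (K : set (R3 R)) (phi : R3 R -> 'rV[R]_3) x :
  compact K -> (forall y, ~ K y -> phi y = 0) -> ~ K x ->
  classical_curl phi x = 0.
Proof.
move=> cK phi0 Kx; have clK := compact_closed (@norm_hausdorff _ _) cK.
have D0 (i j : 'I_3) : 'D_(basis3 j) (fun y => phi y 0 i) x = 0.
  by apply: (derive_outside (basis3 j) clK) => // y /phi0 ->; rewrite mxE.
by apply/rowP => i; rewrite !mxE !D0 subr0.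
Qed.

(** A field compactly supported in Omega is also a test field on the whole space,
    and its curl vanishes off its support. *)
Lemma is_curl0_sub (Omega : set (R3 R)) u :
  is_curl setT u (fun=> 0) -> is_curl Omega u (fun=> 0).
Proof.
move=> curlu phi tphi; have [_ [K [cK KO phi0]]] := tphi.
rewrite !(@cintegral_support Omega) => [|x Ox|x Ox].
- exact: curlu (test_field_setT tphi).
- rewrite big1// => i _.
  rewrite (classical_curl_outside cK phi0); last by move=> /KO.
  by rewrite mxE rmorph0 mulr0.
- by rewrite big1// => i _; rewrite mxE mul0r.
Qed.

Lemma is_curl_real_field0 (Omega : set (R3 R)) (U : 'I_3 -> R3 R -> R) :
  (forall phi, test_field setT phi ->
    \int[mu]_x (\sum_i U i x * classical_curl phi x 0 i) = 0) ->
  is_curl Omega (real_field U) (fun=> 0).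
Proof.
move=> U0; apply: is_curl0_sub => phi tphi; rewrite /cintegral.
have int0 : \int[mu]_x (0 : R) = 0 by rewrite /Rintegral integral0.
transitivity (Complex (0 : R) (0 : R)).
  congr Complex; rewrite -[RHS]int0.
    by apply: eq_Rintegral => x _; rewrite big1// => i _; rewrite mxE mul0r.
  by apply: eq_Rintegral => x _; rewrite big1// => i _; rewrite mxE mul0r.
have E x : \sum_i real_field U x 0 i * real_complex R (classical_curl phi x 0 i) =
    real_complex R (\sum_i U i x * classical_curl phi x 0 i).
  by rewrite rmorph_sum; apply: eq_bigr => i _; rewrite mxE rmorphM.
congr Complex.
  by rewrite -[LHS](U0 _ tphi); apply: eq_Rintegral => x _; rewrite E.
rewrite -[LHS]int0.
by apply: eq_Rintegral => x _; rewrite E.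
Qed.

End fields.

(** * The gradient field and its curl *)

Section layer.
Context {R : realType}.
Local Notation mu := (@lebesgue3 R).
Context (h h' chi chi' : R -> R).

(** The gradient of x_2 + chi(x_3) h(x_2). *)
Definition layer_field (i : 'I_3) (x : R3 R) : R :=
  if i == 1 then 1 + chi x.2.2 * h' x.2.1
  else if i == 2%:R then chi' x.2.2 * h x.2.1 else 0.

Context (dh : forall t : R, is_derive t 1 h (h' t))
  (dchi : forall t : R, is_derive t 1 chi (chi' t))
  (ch' : continuous h') (cchi' : continuous chi').

Let ch : continuous h.
Proof. by move=> t; apply: differentiable_continuous; apply/derivable1_diffP. Qed.

Let cchi : continuous chi.
Proof. by move=> t; apply: differentiable_continuous; apply/derivable1_diffP. Qed.

Let cproj2 (f : R -> R) : continuous f -> continuous (fun x : R3 R => f x.2.1).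
Proof.
move=> cf x; apply: (@continuous_comp _ _ _ snd (f \o fst)); first exact: cvg_snd.
by apply: continuous_comp; [exact: cvg_fst|exact: cf].
Qed.

Let cproj3 (f : R -> R) : continuous f -> continuous (fun x : R3 R => f x.2.2).
Proof.
move=> cf x; apply: (@continuous_comp _ _ _ snd (f \o snd)); first exact: cvg_snd.
by apply: continuous_comp; [exact: cvg_snd|exact: cf].
Qed.

Let ctensor (f g : R -> R) : continuous f -> continuous g ->
  continuous (fun x : R3 R => f x.2.2 * g x.2.1).
Proof. by move=> cf cg x; apply: cvgM; [exact: cproj3|exact: cproj2]. Qed.

Lemma continuous_layer_field i : continuous (layer_field i).
Proof.
rewrite /layer_field; case: (i == 1); last case: (i == 2%:R).
- by move=> x; apply: cvgD; [exact: cvg_cst|exact: ctensor].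
- exact: ctensor.
- by move=> x; exact: cvg_cst.
Qed.

Let U2 := layer_field 1.
Let U3 := layer_field 2%:R.

Let dU2_1 x : is_derive x (basis3 0) U2 0.
Proof.
case: x => t p.
have [_ H] := @is_derive_line _ _ U2 (basis3 0) (fun t => (t, p)) t 0 ((line1E p) ^~ t).
apply: H; exact: (is_derive_cst (1 + chi p.2 * h' p.1)).
Qed.

Let dU3_1 x : is_derive x (basis3 0) U3 0.
Proof.
case: x => t p.
have [_ H] := @is_derive_line _ _ U3 (basis3 0) (fun t => (t, p)) t 0 ((line1E p) ^~ t).
apply: H; exact: (is_derive_cst (chi' p.2 * h p.1)).
Qed.

Let dU2_3 x : is_derive x (basis3 2%:R) U2 (chi' x.2.2 * h' x.2.1).
Proof.
case: x => x1 [x2 t].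
have [_ H] := @is_derive_line _ _ U2 (basis3 2%:R) (fun t => (x1, (x2, t))) t
  (chi' t * h' x2) ((line3E x1 x2) ^~ t).
apply: H; rewrite /U2 /layer_field/comp/=.
by apply: is_derive_eq; rewrite /GRing.scale/= ; ring.
Qed.

Let dU3_2 x : is_derive x (basis3 1) U3 (chi' x.2.2 * h' x.2.1).
Proof.
case: x => x1 [t x3].
have [_ H] := @is_derive_line _ _ U3 (basis3 1) (fun t => (x1, (t, x3))) t
  (chi' x3 * h' t) ((line2E x1 x3) ^~ t).
apply: H; rewrite /U3 /layer_field/comp/=.
by apply: is_derive_eq; rewrite /GRing.scale/= ; ring.
Qed.

(** With U the field and p the test field,
      U . curl p = d_1 (U_3 p_2 - U_2 p_3) - d_2 (U_3 p_1) + d_3 (U_2 p_1),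
    since d_3 U_2 = d_2 U_3 = chi'(x_3) h'(x_2) and U does not depend on x_1.
    The identity differentiates each component of U only in directions in which
    a continuous h' and chi' make it differentiable. *)
Lemma integral_layer_field_curl phi : test_field setT phi ->
  \int[mu]_x (\sum_i layer_field i x * classical_curl phi x 0 i) = 0.
Proof.
move=> [Ck [K [cK _ phi0]]].
have [N KN] := compact_sub_cube cK.
have phi0N x i : ~ cube N x -> phi x 0 i = 0.
  by move=> Nx; rewrite phi0 ?mxE// => /KN.
pose p (i : 'I_3) (x : R3 R) : R := phi x 0 i.
have cp i : continuous (p i) by have [] := Ck i 0%N.
have dp i j x : is_derive x (basis3 j) (p i) ('D_(basis3 j) (p i) x).
  by have [_ /(_ j)[+ _]] := Ck i 1%N => /(_ x) ?; exact/derivableP.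
have cdp i j : continuous ('D_(basis3 j) (p i)).
  by have [_ /(_ j)[_ []]] := Ck i 1%N.
have cU2 : continuous U2 := @continuous_layer_field 1.
have cU3 : continuous U3 := @continuous_layer_field 2%:R.
have cc : continuous (fun x : R3 R => chi' x.2.2 * h' x.2.1) by exact: ctensor.
pose f1 x := U3 x * p 1 x - U2 x * p 2%:R x.
pose g1 x := U3 x * 'D_(basis3 0) (p 1) x - U2 x * 'D_(basis3 0) (p 2%:R) x.
pose f2 x := - (U3 x * p 0 x).
pose g2 x := - (U3 x * 'D_(basis3 1) (p 0) x + chi' x.2.2 * h' x.2.1 * p 0 x).
pose f3 x := U2 x * p 0 x.
pose g3 x := U2 x * 'D_(basis3 2%:R) (p 0) x + chi' x.2.2 * h' x.2.1 * p 0 x.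
have df1 x : is_derive x (basis3 0) f1 (g1 x).
  apply: is_derive_eq.
    exact: is_deriveB (is_deriveM (dU3_1 x) (dp 1 0 x))
                      (is_deriveM (dU2_1 x) (dp 2%:R 0 x)).
  by rewrite /GRing.scale/= /g1; ring.
have df2 x : is_derive x (basis3 1) f2 (g2 x).
  apply: is_derive_eq; first exact: is_deriveN (is_deriveM (dU3_2 x) (dp 0 1 x)).
  by rewrite /GRing.scale/= /g2; ring.
have df3 x : is_derive x (basis3 2%:R) f3 (g3 x).
  apply: is_derive_eq; first exact: is_deriveM (dU2_3 x) (dp 0 2%:R x).
  by rewrite /GRing.scale/= /g3; ring.
have cg1 : continuous g1.
  by move=> x; apply: cvgB; apply: cvgM; try exact: cdp; [exact: cU3|exact: cU2].
have cg2 : continuous g2.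
  move=> x; apply: cvgN; apply: cvgD; apply: cvgM; try exact: cdp; try exact: cp.
    exact: cU3.
  exact: cc.
have cg3 : continuous g3.
  move=> x; apply: cvgD; apply: cvgM; try exact: cdp; try exact: cp.
    exact: cU2.
  exact: cc.
have f10 x : ~ cube N x -> f1 x = 0 by move=> Nx; rewrite /f1 /p !phi0N// !mulr0 subr0.
have f20 x : ~ cube N x -> f2 x = 0 by move=> Nx; rewrite /f2 /p !phi0N// mulr0 oppr0.
have f30 x : ~ cube N x -> f3 x = 0 by move=> Nx; rewrite /f3 /p !phi0N// mulr0.
have [i1 I1] := integral_partial0 df1 cg1 f10.
have [i2 I2] := integral_partial0 df2 cg2 f20.
have [i3 I3] := integral_partial0 df3 cg3 f30.
rewrite (_ : (fun x => _) = (fun x => g1 x + (g2 x + g3 x))).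
  have i23 : mu.-integrable setT (EFin \o (fun x => g2 x + g3 x)).
    exact: integrableD i2 i3.
  rewrite (RintegralD measurableT i1 i23) (RintegralD measurableT i2 i3).
  by rewrite /Rintegral I1 I2 I3 !addr0.
apply/funext => x.
rewrite !big_ord_recl big_ord0 !mxE.
(* The indices of the cyclic formula for the curl are reduced modulo 3. *)
rewrite (_ : lift ord0 ord0 = 1)//; last exact: val_inj.
rewrite (_ : lift ord0 (lift ord0 ord0) = 2%:R)//; last exact: val_inj.
rewrite (_ : 1 + 1 = 2%:R :> 'I_3)//.
rewrite (_ : 1 + 2%:R = 0 :> 'I_3)//; last exact: val_inj.
rewrite (_ : 2%:R + 1 = 0 :> 'I_3)//; last exact: val_inj.
rewrite (_ : 2%:R + 2%:R = 1 :> 'I_3)//; last exact: val_inj.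
have regroup (u2 u3 a b c d k z : R) :
  0 * z + (u2 * (a - b) + (u3 * (c - d) + 0)) =
  u3 * c - u2 * b + (- (u3 * d + k) + (u2 * a + k)) by ring.
exact: regroup.
Qed.

End layer.

(** * The disconnecting field *)

Section disc.
Context {R : realType}.

(** The two points with s = 1 and s = -1 show that the projection of the disc to
    the first axis keeps a positive distance from the ends of the period cell,
    which leaves room for the periodic function to turn back. *)
Lemma closure_disc_pole (z : R2 R) (rho s : R) : 0 < rho -> s ^+ 2 = 1 ->
  closure (disc z rho) (z.1 + s * rho, z.2).
Proof.
move=> rho0 s1 A /nbhs_ballP[e /= e0 eA].
have absS : `|s| = 1.
  by apply/eqP; rewrite -(sqrp_eq1 (normr_ge0 s)) real_normK ?num_real// s1.
pose d := Num.min e rho / 2.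
have d0 : 0 < d by rewrite divr_gt0// lt_min e0.
have de : d < e by rewrite /d; have := ge_min e e rho; rewrite lexx => /= ?; lra.
have dr : d < rho by rewrite /d; have := ge_min rho e rho; rewrite lexx orbT => /= ?; lra.
exists (z.1 + s * (rho - d), z.2); split.
  rewrite /disc/= subrr expr0n addr0 addrAC subrr add0r exprMn s1 mul1r.
  by rewrite ltr_sqr ?nnegrE; lra.
apply: eA; split; last exact: ballxx.
rewrite /ball/= (_ : _ - _ = s * d); last by ring.
by rewrite normrM absS mul1r gtr0_norm.
Qed.

End disc.

Lemma curl_free_field_exists (R : realType) (z0 : R2 R) (rho : R)
    (hrho : 0 < rho) (hdisc : closure (disc z0 rho) `<=` domV) :
  exists U : 'I_3 -> R3 R -> R,
    [/\ forall i, continuous (U i),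
        forall i x, U i (x + basis3 0) = U i x /\ U i (x + basis3 1) = U i x,
        forall phi, test_field setT phi ->
          \int[lebesgue3]_x (\sum_i U i x * classical_curl phi x 0 i) = 0,
        forall i x, disc z0 rho x.2 -> U i x = 0 &
        exists N, forall i x, domZ x -> ~ cube N x -> U i x = (i == 1)%:R].
Proof.
have c1 : rho < z0.1.
  have := hdisc _ (@closure_disc_pole _ z0 rho (- 1) hrho _); rewrite sqrrN expr1n.
  by move=> /(_ erefl)[/=]; rewrite in_itv/= => /andP[? ?] _; lra.
have c2 : rho < 1 - z0.1.
  have := hdisc _ (@closure_disc_pole _ z0 rho 1 hrho _); rewrite expr1n.
  by move=> /(_ erefl)[/=]; rewrite in_itv/= => /andP[? ?] _; lra.
pose c := z0.1; pose sigma := Num.min c (1 - c).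
have [B [B' [cB' dB B1 B0]]] : exists B B' : R -> R, [/\ continuous B',
    forall t : R, is_derive t 1 B (B' t),
    forall t, `|t - c| <= rho -> B t = 1 /\ B' t = 0 &
    forall t, sigma <= `|t - c| -> B t = 0 /\ B' t = 0].
  by apply: bump_exists; rewrite ltW//= lt_min c1 c2.
have [chi [chi' [cchi' dchi chi1 chi0]]] : exists B B' : R -> R, [/\ continuous B',
    forall t : R, is_derive t 1 B (B' t),
    forall t, `|t - z0.2| <= rho -> B t = 1 /\ B' t = 0 &
    forall t, rho + 1 <= `|t - z0.2| -> B t = 0 /\ B' t = 0].
  by apply: bump_exists; rewrite ltW//= ltrDl.
have cB : continuous B.
  by move=> t; apply: differentiable_continuous; apply/derivable1_diffP.
(* G has slope -1 on the projection of the disc, so that t + G t is constant there. *)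
pose G t := - ((t - c) * B t); pose G' t := - (B t + (t - c) * B' t).
have dG (t : R) : is_derive t 1 G (G' t).
  apply: is_derive_eq; rewrite /GRing.scale/= /G'; ring.
have G0 t : t <= 0 -> G t = 0 /\ G' t = 0.
  move=> t0; rewrite /G /G'; have [|-> ->] := B0 t; last by rewrite !mulr0 addr0 oppr0.
  by rewrite distrC ger0_norm /c /sigma ?ge_min; lra.
have G1 t : 1 <= t -> G t = 0 /\ G' t = 0.
  move=> t1; rewrite /G /G'; have [|-> ->] := B0 t; last by rewrite !mulr0 addr0 oppr0.
  rewrite ger0_norm; last by rewrite /c; lra.
  by rewrite ge_min; apply/orP; right; lra.
have cG : continuous G.
  by move=> t; apply: differentiable_continuous; apply/derivable1_diffP.
have cG' : continuous G'.
  move=> t; apply: cvgN; apply: cvgD; first exact: cB.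
  by apply: cvgM; [apply: cvgB; [exact: cvg_id|exact: cvg_cst]|exact: cB'].
have ch' : continuous (periodize G').
  by apply: continuous_periodize => // t; [move=> /G0[]|move=> /G1[]].
have dh (t : R) : is_derive t 1 (periodize G) (periodize G' t).
  exact: is_derive_periodize.
have periodizeV (f : R -> R) (t : R) : 0 < t < 1 -> periodize f t = f t.
  move=> /andP[t0 t1]; rewrite /periodize (_ : Num.floor t = 0) ?subr0//.
  by apply: floor_def; rewrite add0r ltW.
exists (layer_field (periodize G) (periodize G') chi chi'); split.
- exact: continuous_layer_field.
- move=> i x; rewrite /layer_field /=.
  by rewrite !addr0 !periodize_add1.
- exact: integral_layer_field_curl.
- move=> i x Dx.
  have disc1 : `|x.2.1 - z0.1| <= rho /\ `|x.2.2 - z0.2| <= rho.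
    move: Dx; rewrite /disc/= => Dx; have rho0 := ltW hrho.
    by split; rewrite -ler_sqr ?nnegrE// real_normK ?num_real//;
      have := sqr_ge0 (x.2.1 - z0.1); have := sqr_ge0 (x.2.2 - z0.2); lra.
  have [x1 x2] := disc1.
  have x01 : 0 < x.2.1 < 1.
    by move: x1; rewrite ler_norml => /andP[? ?]; apply/andP; split; lra.
  rewrite /layer_field !periodizeV// /G /G'.
  have [-> ->] := B1 _ x1; have [-> ->] := chi1 _ x2.
  by rewrite mulr0 addr0 mulrN1 subrr mul0r; case: ifP => _ //; case: ifP.
- exists (Num.max 1 (`|z0.2| + rho + 1)) => i x [/= x1 [x2 _]] Nx.
  rewrite /layer_field.
  have [-> ->] : chi x.2.2 = 0 /\ chi' x.2.2 = 0; last first.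
    by case: eqP => // _; rewrite mul0r ?addr0//; case: ifP.
  apply: chi0; rewrite leNgt; apply/negP => x3; apply: Nx.
  move: x1 x2; rewrite /cube/= !in_itv/= -!ler_norml !le_max.
  move=> /andP[? ?] /andP[? ?]; rewrite !ler_norml.
  split; [|split]; apply/orP; [left|left|right]; try by apply/andP; split; lra.
  by rewrite -ler_norml; have := ler_normD (x.2.2 - z0.2) z0.2; rewrite subrK; lra.
Qed.

Theorem proposition6p6 (R : realType) (z0 : R2 R) (rho : R)
    (hz0 : domV z0) (hrho : 0 < rho) (hdisc : closure (disc z0 rho) `<=` domV)
    (eta : nat -> R) (heta : forall n, 0 < eta n)
    (eta0 : eta n @[n --> \oo] --> (0 : R))
    (r : nat -> R) (hr : forall n, 0 < r n <= rho)
    (I : nat -> set R) (hI : forall n, finite_union_open_itv (I n))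
    (I01 : forall n, I n `<=` `]0, 1[) :
  let Sigma := fun n => wire z0 (r n) (I n) in
  asymptotically_disconnected eta Sigma 1 /\
  exists Phi : R3 R -> 'rV[R[i]]_3, disconnecting eta Sigma 1 (fun=> Phi).
Proof.
move=> Sigma.
suff [Phi HPhi] : exists Phi : R3 R -> 'rV[R[i]]_3, disconnecting eta Sigma 1 (fun=> Phi).
  by split; [exists (fun=> Phi)|exists Phi].
have [U [cU perU curlU U0 [N UN]]] := @curl_free_field_exists R z0 rho hrho hdisc.
exists (real_field U); split.
- move=> _; exists (real_field U); split => //.
  + split; first exact: L2loc_real_field.
    exists (fun=> 0); split; first exact: L2loc0.
    exact: is_curl_real_field0.
  + by apply: aeW => x; apply/rowP => i; rewrite !mxE (perU i x).1.
  + by apply: aeW => x; apply/rowP => i; rewrite !mxE (perU i x).2.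
- have -> : (fun x => real_field U x - evec 1)%R =
            real_field (fun i x => U i x - (i == 1)%:R).
    apply/funext => x; apply/rowP => i; rewrite !mxE eqxx/= rmorphB/=.
    by rewrite rmorph_nat.
  set V := fun i x => U i x - (i == 1)%:R.
  have Vfin : (L2norm domZ (real_field V) < +oo)%E.
    apply: (@L2norm_lty _ _ _ N).
    + by apply: measurableX => //; apply: measurableX.
    + apply: continuous_cnorm => i x; apply: cvgB; [exact: cU|exact: cvg_cst].
    + by move=> x Zx Nx; apply/rowP => i; rewrite !mxE /V UN// subrr.
  have -> : L2norm domZ (real_field V) = (fine (L2norm domZ (real_field V)))%:E.
    by rewrite fineK// ge0_fin_numE// Lnorm_ge0.
  under eq_fun do rewrite -EFinM.
  apply: cvg_EFin; first by near=> n.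
  rewrite -[X in _ --> X](mul0r (fine (L2norm domZ (real_field V)))).
  apply: cvgM; last exact: cvg_cst.
  rewrite -[X in _ --> X](@sqrtr0 R).
  exact: continuous_cvg (@sqrt_continuous R 0) eta0.
- move=> n; apply: aeW => x [_ Dx]; apply/rowP => i; rewrite !mxE U0//.
  move: Dx; rewrite /disc/= => /lt_le_trans; apply.
  by have /andP[? ?] := hr n; rewrite ler_sqr// nnegrE ltW.
- exists (fun _ _ => 0); split => [n|].
    by split; [exact: L2loc0|exact: is_curl_real_field0].
  under eq_fun do rewrite L2norm0 mule0.
  exact: cvg_cst.
Unshelve. all: by end_near. Qed.
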